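(* Consider the block-randomized sampling process described in the context, and suppose that $\mathbf{p}\in\mathbb{R}^{J_n}$, with $n=\xi_{(t)}$, is either the leverage-based or the Euclidean-based sampling distribution. Let $\mathbf{R}^{(n)}_{(t)}=\mathbf{A}^{(n)}_{(t)}(\mathbf{Z}^{(n)}_{(t)})^\top-\mathbf{X}_{(n)}$. Then $$\mathbb{E}_{\zeta_{(t)}}\left[\left\|\mathbf{G}^{(\xi_{(t)})}_{(t)}-\nabla_{\mathbf{A}^{(\xi_{(t)})}}f(\boldsymbol{\theta}_{(t)})\right\|_F^2\;\middle|\;\mathcal{B}_{(t)},\xi_{(t)}\right]=\frac1{|\mathcal{F}_n|}\sum_{j=1}^{J_n}\frac1{p_j}\left\|\mathbf{R}^{(\xi_{(t)})}_{(t)}(:,j)\right\|_2^2\left\|\mathbf{Z}^{(\xi_{(t)})}_{(t)}(j,:)\right\|_2^2-\frac1{|\mathcal{F}_n|}\left\|\nabla_{\mathbf{A}^{(\xi_{(t)})}}f(\boldsymbol{\theta}_{(t)})\right\|_F^2 ,$$ where terms with $p_j=0$ (for which $\mathbf{Z}^{(\xi_{(t)})}_{(t)}(j,:)=0$) are read as $0$.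
   Context: Let $\mathcal{X}\in\mathbb{R}^{I_1\times\cdots\times I_N}$ be a tensor, let $R$ be a positive integer with $I_k>R$ for all $k$, and let $\boldsymbol{\theta}=[\mathbf{A}^{(1)},\dots,\mathbf{A}^{(N)}]$ with factor matrices $\mathbf{A}^{(k)}\in\mathbb{R}^{I_k\times R}$. For a mode $n$ put $J_n=\prod_{m\ne n}I_m$. Indices $j\in\{1,\dots,J_n\}$ are in bijection with multi-indices $(i_k)_{k\neq n}$, $1\le i_k\le I_k$, via $j=1+\sum_{k\ne n}(i_k-1)\prod_{m<k,\,m\neq n}I_m$. The mode-$n$ unfolding $\mathbf{X}_{(n)}\in\mathbb{R}^{I_n\times J_n}$ has entry $\mathcal{X}_{i_1,\dots,i_N}$ at position $(i_n,j)$. The Khatri-Rao matrix $\mathbf{Z}^{(n)}=\mathbf{A}^{(N)}\odot\cdots\odot\mathbf{A}^{(n+1)}\odot\mathbf{A}^{(n-1)}\odot\cdots\odot\mathbf{A}^{(1)}\in\mathbb{R}^{J_n\times R}$ has as its $j$-th row the entrywise (Hadamard) product of the rows $\mathbf{A}^{(k)}(i_k,:)$, $k\neq n$; $\mathbf{Z}^{(n)}_{(t)}$ is this matrix computed at $\boldsymbol{\theta}_{(t)}$. Objective: $f(\boldsymbol{\theta})=\frac12\|\mathcal{X}-\sum_{r=1}^R\mathbf{a}^{(1)}_r\circ\cdots\circ\mathbf{a}^{(N)}_r\|_F^2=\frac12\|\mathbf{Z}^{(n)}(\mathbf{A}^{(n)})^\top-\mathbf{X}_{(n)}^\top\|_F^2$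 for each $n$, where $\mathbf{a}^{(k)}_r$ is the $r$-th column of $\mathbf{A}^{(k)}$ and $\circ$ is the outer product. For a given mode $n$, $f=\frac1{J_n}\sum_{j=1}^{J_n}f_j$ with $f_j(\boldsymbol{\theta})=\frac{J_n}{2}\|\mathbf{Z}^{(n)}(j,:)(\mathbf{A}^{(n)})^\top-\mathbf{X}_{(n)}^\top(j,:)\|_2^2$. Sampling probabilities for the rows of $\mathbf{Z}^{(n)}$, where $j$ corresponds to $(i_k)_{k\neq n}$: (i) leverage-based: $p_j=\prod_{k\ne n}\ell_{i_k}(\mathbf{A}^{(k)})/R$, where the leverage score is $\ell_i(\mathbf{A})=\|\mathbf{Q}(i,:)\|_2^2$ for any $\mathbf{Q}\in\mathbb{R}^{I_k\times R}$ whose columns form an orthonormal basis of the column space of $\mathbf{A}$ (so the $\mathbf{A}^{(k)}$, $k\ne n$, have full column rank); (ii) Euclidean-based: $p_j=\prod_{k\ne n}\|\mathbf{A}^{(k)}(i_k,:)\|_2^2/\|\mathbf{A}^{(k)}\|_F^2$ (so the $\mathbf{A}^{(k)}$, $k\neq n$, are nonzero). Process: $\boldsymbol{\theta}_{(0)}$ is given. At iteration $t$, a mode $\xi_{(t)}=n$ is drawn uniformly from $\{1,\dots,N\}$, independently of the past. Then, given the past and $n$, a batch $\zeta_{(t)}=(j_1,\dots,j_{|\mathcal{F}_n|})$ of fixed size $|\mathcal{F}_n|\ge1$ is drawn i.i.d. (with replacement) from $\mathbf{p}=(p_j)_{j=1}^{J_n}$ computed at $\boldsymbol{\theta}_{(t)}$.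 The stochastic gradient is $$\mathbf{G}^{(n)}_{(t)}=\frac{1}{|\mathcal{F}_n|J_n}\sum_{s=1}^{|\mathcal{F}_n|}\frac1{p_{j_s}}\nabla_{\mathbf{A}^{(n)}}f_{j_s}(\boldsymbol{\theta}_{(t)}),$$ and $\boldsymbol{\theta}_{(t+1)}$ is obtained by $\mathbf{A}^{(n)}_{(t+1)}=\mathbf{A}^{(n)}_{(t)}-\alpha_t\mathbf{G}^{(n)}_{(t)}$ with a deterministic step size $\alpha_t$, leaving the other factor matrices unchanged. $\mathcal{B}_{(t)}$ is the filtration generated by $\xi_{(0)},\zeta_{(0)},\dots,\xi_{(t-1)},\zeta_{(t-1)}$, so $\boldsymbol{\theta}_{(t)}$ is determined by $\mathcal{B}_{(t)}$. $\mathbb{E}_{\zeta_{(t)}}[\cdot\mid\mathcal{B}_{(t)},\xi_{(t)}]$ denotes conditional expectation over $\zeta_{(t)}$. *)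

(* Defs.v *)
From HB Require Import structures.
From mathcomp Require Import all_boot all_order all_algebra.
From mathcomp Require Import all_classical all_reals all_analysis.

Set Implicit Arguments.
Unset Strict Implicit.
Unset Printing Implicit Defensive.

Import Order.TTheory GRing.Theory Num.Theory.
Import numFieldNormedType.Exports.

Local Open Scope classical_set_scope.
Local Open Scope ring_scope.

Section MatrixNotions.
Context {R : realType}.

(* Squared Frobenius norm; on a row or a column it is the squared 2-norm.
   (The library norm on matrices is the max norm.) *)
Definition frob2 m n (A : 'M[R]_(m, n)) : R := \sum_i \sum_j A i j ^+ 2.

Definition orthonormal_basis m r (A Q : 'M[R]_(m, r)) : Prop :=
  Q^T *m Q = 1%:M /\ (Q^T == A^T)%MS.

(* If A does not have full column rank there is no such Q, and the value of
   [leverage] is then irrelevant; otherwise it does not depend on Q, see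
   [leverageE]. *)
Definition leverage m r (A : 'M[R]_(m, r)) (i : 'I_m) : R :=
  frob2 (row i (xget 0 [set Q | orthonormal_basis A Q])).

Lemma leverageE m r (A Q : 'M[R]_(m, r)) (i : 'I_m) :
  orthonormal_basis A Q -> leverage A i = frob2 (row i Q).
Proof.
move=> hQ; rewrite /leverage; case: xgetP => [Q' _ [Q'1 Q'A]|/(_ Q)//].
case: hQ => Q1 QA.
have frowE (B : 'M[R]_(m, r)) : frob2 (row i B) = (B *m B^T) i i.
  by rewrite /frob2 big_ord1 mxE; apply: eq_bigr => j _; rewrite !mxE expr2.
rewrite !frowE; congr (fun_of_matrix _ i i).
have /submxP[M /(congr1 trmx)] : (Q'^T <= Q^T)%MS.
  by rewrite (eqmxP Q'A) (eqmxP QA).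
rewrite trmx_mul !trmxK => Q'E.
have /mulmx1C MM : M *m M^T = 1%:M.
  by rewrite -Q'1 Q'E trmx_mul trmxK mulmxA -(mulmxA M) Q1 mulmx1.
by rewrite Q'E trmx_mul trmxK mulmxA -(mulmxA Q) MM mulmx1.
Qed.

End MatrixNotions.

Inductive sampling := Leverage | Euclidean.

Section CP.
Context {R : realType} {N : nat}.
Variables (dim : 'I_N -> nat) (rk : nat).
Hypothesis rk_lt_dim : forall k, (rk < dim k)%N.

Definition tensor := {dffun forall k : 'I_N, 'I_(dim k)} -> R.

Definition factors := forall k : 'I_N, 'M[R]_(dim k, rk).

Definition set_factor (th : factors) (n : 'I_N) (B : 'M[R]_(dim n, rk))
    : factors :=
  dfwith th n B.

Definition J (n : 'I_N) : nat := \prod_(m < N | m != n) dim m.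

Definition stride (n k : 'I_N) : nat :=
  \prod_(m < N | (m < k)%N && (m != n)) dim m.

(* Mixed-radix digits of the (0-based) column index j, see [coord_sum]; the
   coordinate k = n is not meaningful. *)
Definition coord (n : 'I_N) (j : 'I_(J n)) (k : 'I_N) : 'I_(dim k) :=
  Ordinal (ltn_pmod (j %/ stride n k) (leq_ltn_trans (leq0n rk) (rk_lt_dim k))).

Lemma coord_sum (n : 'I_N) (j : 'I_(J n)) :
  (\sum_(k < N | k != n) coord j k * stride n k)%N = j.
Proof.
pose S K := (\prod_(m < N | (m < K)%N && (m != n)) dim m)%N.
suff H K : (K <= N)%N ->
    (\sum_(k < N | (k < K)%N && (k != n)) coord j k * stride n k = j %% S K)%N.
  transitivity (j %% S N)%N.
    by rewrite -H//; apply: eq_bigl => k; rewrite ltn_ord.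
  rewrite modn_small// (leq_trans (ltn_ord j))// /J /S.
  by under [X in (_ <= X)%N]eq_bigl do rewrite ltn_ord.
elim: K => [_|K IH KN]; first by rewrite big_pred0// /S big_pred0// modn1.
pose k0 := Ordinal KN.
have ltS (k : 'I_N) : (k < K.+1)%N && (k != k0) = (k < K)%N.
  by rewrite ltnS leq_eqVlt -val_eqE /=; case: ltngtP.
have [k0n|k0n] := eqVneq k0 n.
  have E (k : 'I_N) : (k < K.+1)%N && (k != n) = (k < K)%N && (k != n).
    by rewrite -k0n -[in RHS]ltS -andbA andbb.
  by rewrite /S !(eq_bigl _ _ E) IH// ltnW.
have E (k : 'I_N) : (k < K.+1)%N && (k != n) && (k != k0) = (k < K)%N && (k != n).
  by rewrite andbAC ltS.
have k0P : (k0 < K.+1)%N && (k0 != n) by rewrite ltnSn.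
have SE : S K.+1 = (dim k0 * S K)%N.
  by rewrite /S (bigD1 k0)//=; congr muln; apply: eq_bigl => k; rewrite E.
rewrite (bigD1 k0)//= (eq_bigl _ _ E) IH ?(ltnW KN)// SE.
rewrite -[stride n k0]/(S K).
have := divn_eq (j %% (dim k0 * S K)) (S K).
by rewrite modn_dvdm ?dvdn_mull// => ->; rewrite -modn_divl.
Qed.

Definition unfold (X : tensor) (n : 'I_N) : 'M[R]_(dim n, J n) :=
  \matrix_(a, j) X (finfun (dfwith (coord j) n a)).

Definition khatri_rao (th : factors) (n : 'I_N) : 'M[R]_(J n, rk) :=
  \matrix_(j, r) \prod_(k < N | k != n) th k (coord j k) r.

Definition objective (X : tensor) (th : factors) : R :=
  2^-1 * \sum_i (X i - \sum_(r < rk) \prod_(k < N) th k (i k) r) ^+ 2.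

Definition objective_row (X : tensor) (n : 'I_N) (j : 'I_(J n)) (th : factors)
    : R :=
  (J n)%:R / 2 *
  frob2 (row j (khatri_rao th n) *m (th n)^T - row j (unfold X n)^T).

(* The matrix of partial derivatives of g with respect to the entries of the
   n-th factor, the other factors being fixed. *)
Definition grad (n : 'I_N) (g : factors -> R) (th : factors)
    : 'M[R]_(dim n, rk) :=
  \matrix_(a, r) 'D_(delta_mx a r)
    (fun B : 'M[R]_(dim n, rk) => g (set_factor th B)) (th n).

Definition admissible (sch : sampling) (th : factors) (n : 'I_N) : Prop :=
  match sch with
  | Leverage => forall k, k != n -> \rank (th k) = rk
  | Euclidean => forall k, k != n -> th k != 0
  end.

Definition prob (sch : sampling) (th : factors) (n : 'I_N) (j : 'I_(J n)) : R :=
  match sch with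
  | Leverage => \prod_(k < N | k != n) (leverage (th k) (coord j k) / rk%:R)
  | Euclidean =>
      \prod_(k < N | k != n) (frob2 (row (coord j k) (th k)) / frob2 (th k))
  end.

Variable bsize : 'I_N -> nat.

Definition batch (n : 'I_N) : Type := (bsize n).-tuple 'I_(J n).

(* Rows with probability 0 are almost surely not drawn, so the convention
   0^-1 = 0 plays no role here. *)
Definition sgrad (X : tensor) (sch : sampling) (th : factors) (n : 'I_N)
    (z : batch n) : 'M[R]_(dim n, rk) :=
  ((bsize n)%:R * (J n)%:R)^-1 *:
  \sum_(s < bsize n)
    (prob sch th (tnth z s))^-1 *: grad n (objective_row X (tnth z s)) th.

Section Process.
Context {d : measure_display} {T : measurableType d}.
Variables (P : probability T R) (X : tensor) (alpha : nat -> R).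
(* The family of sampling distributions may vary with iteration and mode. *)
Variables (sch : nat -> 'I_N -> sampling) (th0 : factors).
Variables (xi : nat -> T -> 'I_N) (zeta : forall (s : nat) (w : T), batch (xi s w)).

Fixpoint theta (s : nat) (w : T) : factors :=
  if s is s'.+1 then
    let th := theta s' w in
    let n := xi s' w in
    set_factor th (th n - alpha s' *: sgrad X (sch s' n) th (zeta s' w))
  else th0.

Definition draw (s : nat) (w : T) : {n : 'I_N & batch n} :=
  Tagged batch (zeta s w).

(* (xi_u, zeta_u) takes finitely many values, so the events {draw u = x}
   generate its sigma-algebra. *)
Definition past_events (s : nat) : set (set T) :=
  [set E | exists2 u, (u < s)%N & exists x, E = [set w | draw u w = x]].

Definition past (s : nat) : set (set T) := <<s past_events s >>.

Definition past_and_mode (s : nat) : set (set T) :=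
  <<s past_events s `|` [set E | exists n, E = [set w | xi s w = n]] >>.

(* The iterations 0, ..., t are run according to the algorithm.  The two laws
   are the conditional laws of xi_s given the past, and of zeta_s given the past
   and xi_s, written without division. *)
Record sampling_process (t : nat) : Prop := SamplingProcess {
  draw_measurable : forall s x, (s <= t)%N ->
    measurable [set w | draw s w = x] ;
  draw_admissible : {ae P, forall w, forall s, (s <= t)%N ->
    admissible (sch s (xi s w)) (theta s w) (xi s w)} ;
  mode_law : forall s n H, (s <= t)%N -> past s H ->
    P (H `&` [set w | xi s w = n]) = (P H * (N%:R^-1)%:E)%E ;
  batch_law : forall s n (z : batch n) H, (s <= t)%N -> past s H ->
    P (H `&` [set w | draw s w = Tagged batch z]) =
    (\int[P]_(w in H `&` [set w | xi s w = n])
      (\prod_(i < bsize n) prob (sch s n) (theta s w) (tnth z i))%:E)%E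
}.

End Process.

End CP.

(* Y is a version of the conditional expectation of X given the
   sub-sigma-algebra G. *)
Definition is_cond_exp {R : realType} {d : measure_display}
    {T : measurableType d} (P : probability T R) (G : set (set T))
    (X Y : T -> R) : Prop :=
  [/\ P.-integrable setT (EFin \o X),
      P.-integrable setT (EFin \o Y),
      (forall B : set R, measurable B -> G (Y @^-1` B)) &
      forall A, G A ->
        (\int[P]_(w in A) (Y w)%:E = \int[P]_(w in A) (X w)%:E)%E].

(* Main.v *)
(* Conditionally on the past and on the mode, the factors are constant and the
   batch is i.i.d. with law p, so the stochastic gradient is the mean of b
   independent copies of V_j = p_j^-1 R(:,j) Z(j,:), j ~ p, where b is the
   batch size.  Both sampling laws sum to 1 and p_j = 0 forces Z(j,:) = 0, hence
   V has mean the full gradient and the identity is the variance formula for an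
   i.i.d. mean.  As the draws take finitely many values, conditioning reduces to
   integrating over each of the finitely many atoms of the sigma-algebra. *)
Require Import Defs.
From HB Require Import structures.
From mathcomp Require Import all_boot all_order all_algebra.
From mathcomp Require Import all_classical all_reals all_analysis.
From mathcomp Require Import ring.

Set Implicit Arguments.
Unset Strict Implicit.
Unset Printing Implicit Defensive.

Import Order.TTheory GRing.Theory Num.Theory.
Import numFieldNormedType.Exports.

Local Open Scope classical_set_scope.
Local Open Scope ring_scope.

(** * Algebra of the squared Frobenius norm *)

Section Frobenius.
Context {R : realType}.

Lemma frob2_ge0 m n (A : 'M[R]_(m, n)) : 0 <= frob2 A.
Proof. by do 2![apply: sumr_ge0 => ? _]; exact: sqr_ge0. Qed.

Lemma frob2_eq0 m n (A : 'M[R]_(m, n)) : (frob2 A == 0) = (A == 0).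
Proof.
apply/eqP/eqP => [A0|->]; last first.
  by rewrite /frob2 big1// => i _; rewrite big1// => j _; rewrite mxE expr0n.
apply/matrixP => i j; rewrite mxE; apply/eqP; rewrite -sqrf_eq0.
have /psumr_eq0P/(_ i isT) : \sum_i \sum_j A i j ^+ 2 = 0 by [].
move=> /(_ (fun i _ => sumr_ge0 _ (fun j _ => sqr_ge0 _))).
by move=> /psumr_eq0P/(_ j isT)->// k _; exact: sqr_ge0.
Qed.

Lemma frob2_sum_row m n (A : 'M[R]_(m, n)) : \sum_i frob2 (row i A) = frob2 A.
Proof.
apply: eq_bigr => i _; rewrite /frob2 big_ord1.
by apply: eq_bigr => j _; rewrite mxE.
Qed.

Lemma frob2E m n (A : 'M[R]_(m, n)) : frob2 A = \tr (A^T *m A).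
Proof.
rewrite /frob2 exchange_big; apply: eq_bigr => j _; rewrite mxE.
by apply: eq_bigr => i _; rewrite mxE expr2.
Qed.

Lemma row_mul_tr n (v : 'rV[R]_n) : v *m v^T = (frob2 v)%:M.
Proof.
apply/matrixP => i j; rewrite !ord1 !mxE mulr1n /frob2 big_ord1.
by apply: eq_bigr => k _; rewrite mxE expr2.
Qed.

Lemma mulr_frob2 m n (c : R) (A : 'M[R]_(m, n)) :
  c * frob2 A = \sum_i \sum_j c * A i j ^+ 2.
Proof. by rewrite mulr_sumr; apply: eq_bigr => i _; rewrite mulr_sumr. Qed.

Lemma frob2Z m n (c : R) (A : 'M[R]_(m, n)) : frob2 (c *: A) = c ^+ 2 * frob2 A.
Proof.
rewrite mulr_frob2; apply: eq_bigr => i _.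
by apply: eq_bigr => j _; rewrite mxE exprMn.
Qed.

Lemma frob2_mul_col_row m n (u : 'cV[R]_m) (v : 'rV[R]_n) :
  frob2 (u *m v) = frob2 u * frob2 v.
Proof.
rewrite /frob2 mulr_suml; apply: eq_bigr => i _.
rewrite !big_ord1 mulr_sumr; apply: eq_bigr => j _.
by rewrite mxE big_ord1 exprMn.
Qed.

Lemma frob2DZ n (h : R) (u v : 'rV[R]_n) :
  frob2 (u + h *: v) = frob2 u + h * (2 * \sum_j u ord0 j * v ord0 j) + h ^+ 2 * frob2 v.
Proof.
rewrite /frob2 !big_ord1 !mulr_sumr -!big_split/=; apply: eq_bigr => j _.
by rewrite !mxE; ring.
Qed.

End Frobenius.

(** * Variance of the mean of an i.i.d. finite sample *)

Section IidMean.
Context {R : realType} {I : finType}.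

(** Distributivity of products over sums, with choice functions recoded as tuples: under a product
    law, expectations of products of functions of separate draws factor. *)
Lemma sum_tuple_prod b (F : 'I_b -> I -> R) :
  \sum_(z : b.-tuple I) \prod_i F i (tnth z i) = \prod_i \sum_j F i j.
Proof.
rewrite bigA_distr_bigA/= (reindex (fun f : {ffun 'I_b -> I} => [tuple f i | i < b]))/=.
  by apply: eq_bigr => f _; apply: eq_bigr => i _; rewrite tnth_mktuple.
apply: onW_bij; exists (fun z : b.-tuple I => finfun (tnth z)) => [f|z].
  by apply/ffunP => i; rewrite ffunE tnth_mktuple.
by apply/eq_from_tnth => i; rewrite tnth_mktuple ffunE.
Qed.

Variables (p : I -> R) (p1 : \sum_j p j = 1).

(* Off the diagonal the two factors are independent and centred. *)
Lemma sum_tuple_centred b (v : I -> R) (s s' : 'I_b) : \sum_j p j * v j = 0 ->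
  \sum_(z : b.-tuple I) (\prod_i p (tnth z i)) * (v (tnth z s) * v (tnth z s'))
  = if s == s' then \sum_j p j * v j ^+ 2 else 0.
Proof.
move=> v0.
(* [v] at the single draw [r] is written as a product over all draws, padded by 1, so that
   [sum_tuple_prod] applies. *)
pose w (r i : 'I_b) j := if i == r then v j else 1.
have wE r (z : b.-tuple I) : \prod_i w r i (tnth z i) = v (tnth z r).
  rewrite (bigD1 r)//= /w eqxx big1 ?mulr1// => i /negPf ir.
  by rewrite ir.
transitivity (\prod_i \sum_j p j * (w s i j * w s' i j)).
  rewrite -sum_tuple_prod; apply: eq_bigr => z _.
  by rewrite !big_split/= !wE.
case: eqVneq => [<-|ss'].
  rewrite (bigD1 s)//= [X in _ * X]big1 ?mulr1.
    by apply: eq_bigr => j _; rewrite /w eqxx expr2.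
  move=> i /negPf is_; rewrite -[RHS]p1; apply: eq_bigr => j _.
  by rewrite /w is_ !mulr1.
rewrite (bigD1 s)//= [X in X * _](_ : _ = 0) ?mul0r// -[RHS]v0.
by apply: eq_bigr => j _; rewrite /w eqxx (negPf ss') mulr1.
Qed.

Lemma variance_mean b (v : I -> R) : (0 < b)%N ->
  let mu := \sum_j p j * v j in
  \sum_(z : b.-tuple I) (\prod_i p (tnth z i)) *
     (b%:R^-1 * (\sum_s v (tnth z s)) - mu) ^+ 2
  = b%:R^-1 * (\sum_j p j * v j ^+ 2 - mu ^+ 2).
Proof.
move=> b0 mu; have bN0 : b%:R != 0 :> R by rewrite pnatr_eq0 -lt0n.
pose u j := v j - mu.
have u0 : \sum_j p j * u j = 0.
  under eq_bigr do rewrite mulrBr.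
  by rewrite sumrB -mulr_suml p1 mul1r subrr.
have u2 : \sum_j p j * u j ^+ 2 = \sum_j p j * v j ^+ 2 - mu ^+ 2.
  transitivity (\sum_j (p j * v j ^+ 2 - 2 * mu * (p j * v j) + mu ^+ 2 * p j)).
    by apply: eq_bigr => j _; rewrite /u; ring.
  by rewrite big_split/= sumrB -!mulr_sumr p1 -/mu; ring.
(* The square of the centred sum is expanded over pairs of draws; only the [b] diagonal pairs
   survive, which turns [b^-2] into [b^-1]. *)
transitivity (b%:R^-1 ^+ 2 * \sum_(s < b) \sum_(s' < b)
    \sum_(z : b.-tuple I) (\prod_i p (tnth z i)) * (u (tnth z s) * u (tnth z s'))).
  under [in RHS]eq_bigr do rewrite exchange_big/=.
  rewrite exchange_big/= mulr_sumr; apply: eq_bigr => z _.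
  under [in RHS]eq_bigr do rewrite -mulr_sumr -mulr_sumr.
  rewrite -mulr_sumr -mulr_suml -expr2 [RHS]mulrCA -exprMn; congr (_ * _ ^+ 2).
  rewrite sumrB sumr_const card_ord mulrBr; congr (_ - _).
  by rewrite -[mu *+ b]mulr_natl mulrA mulVf// mul1r.
under eq_bigr => s _ do under eq_bigr => s' _ do rewrite sum_tuple_centred//.
rewrite (eq_bigr (fun=> \sum_j p j * u j ^+ 2)) => [|s _]; last first.
  by rewrite -big_mkcond (big_pred1 s)// => s'; rewrite eq_sym.
rewrite sumr_const card_ord u2 -[X in _ * X]mulr_natl mulrA expr2.
by rewrite -(mulrA b%:R^-1) mulVf// mulr1.
Qed.

(** Both sides are sums over matrix entries, so the scalar identity applies entrywise. *)
Lemma frob2_variance_mean b m n (V : I -> 'M[R]_(m, n)) : (0 < b)%N ->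
  let mu := \sum_j p j *: V j in
  \sum_(z : b.-tuple I) (\prod_i p (tnth z i)) *
     frob2 (b%:R^-1 *: (\sum_s V (tnth z s)) - mu)
  = b%:R^-1 * (\sum_j p j * frob2 (V j) - frob2 mu).
Proof.
move=> b0 mu.
have muE i k : mu i k = \sum_j p j * V j i k.
  by rewrite /mu summxE; apply: eq_bigr => j _; rewrite mxE.
under eq_bigr => z _ do rewrite mulr_frob2.
under [in RHS]eq_bigr => j _ do rewrite mulr_frob2.
rewrite exchange_big/= [in RHS]exchange_big/= -sumrB mulr_sumr.
apply: eq_bigr => i _.
rewrite exchange_big/= [in RHS]exchange_big/= -sumrB mulr_sumr.
apply: eq_bigr => k _.
rewrite muE -(variance_mean (fun j => V j i k) b0) -muE.
by apply: eq_bigr => z _; rewrite !mxE summxE.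
Qed.

End IidMean.

(** * Orthonormal bases and leverage scores *)

Section Leverage.
Context {R : realType}.

(** Gram-Schmidt, by induction on the number of rows: the first row is orthogonalised against an
    orthonormal basis [Q] of the others. *)
Lemma orthonormal_rows m r (B : 'M[R]_(r, m)) : row_free B ->
  exists2 Q : 'M[R]_(r, m), Q *m Q^T = 1%:M & (Q == B)%MS.
Proof.
elim: r B => [|r IH].
  by move=> B; exists B; rewrite ?submx_refl// flatmx0 [RHS]flatmx0.
rewrite -[r.+1]/(1 + r)%N => B; rewrite -[B]vsubmxK.
move: (usubmx B) (dsubmx B) => u C BCfree.
have uC_free (a : 'M[R]_1) (w : 'rV[R]_r) : (a *m u + w *m C = 0) -> (a = 0) /\ (w = 0).
  rewrite -mul_row_col => /eqP; rewrite mulmx_free_eq0// => /eqP aw0.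
  by apply/eq_row_mx; rewrite aw0 row_mx0.
have [|Q QQ /andP[QC CQ]] := IH C.
  by apply: inj_row_free => w wC; apply: (uC_free 0 w _).2; rewrite mul0mx add0r.
pose v : 'rV[R]_m := u - u *m Q^T *m Q.
have vQ : v *m Q^T = 0 by rewrite mulmxBl -!mulmxA QQ mulmx1 subrr.
(* Otherwise [u] would lie in the row space of [C], a nontrivial relation among the rows of [B]. *)
have v0 : v != 0.
  apply/negP => /eqP v0; have /submxP[W WE] := submx_trans (submxMl (u *m Q^T) Q) QC.
  have [/matrixP/(_ ord0 ord0)/eqP] : (1%:M : 'M[R]_1) = 0 /\ - W = 0.
    by apply: uC_free; rewrite mul1mx mulNmx -WE.
  by rewrite !mxE oner_eq0.
pose c : R := Num.sqrt (frob2 v).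
have c0 : c != 0 by rewrite sqrtr_eq0 -ltNge lt0r frob2_eq0 v0 frob2_ge0.
have vv : v *m v^T = (c ^+ 2)%:M.
  by rewrite row_mul_tr /c sqr_sqrtr ?frob2_ge0.
exists (col_mx (c^-1 *: v) Q).
  rewrite tr_col_mx mul_col_row linearZ/= -!scalemxAl -!scalemxAr QQ vv vQ.
  rewrite -[Q *m v^T]trmxK trmx_mul trmxK vQ trmx0 !scaler0.
  by rewrite scalar_mx_block !scale_scalar_mx expr2 mulKf// mulVf.
apply/andP; split; rewrite col_mx_sub; apply/andP; split.
- rewrite scalemx_sub// addmx_sub ?eqmx_opp//.
    by rewrite -addsmxE addsmxSl.
  by rewrite (submx_trans (submxMl _ _))// (submx_trans QC)// -addsmxE addsmxSr.
- by rewrite (submx_trans QC)// -addsmxE addsmxSr.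
- rewrite -addsmxE -[u](subrK (u *m Q^T *m Q)) -/v addmx_sub_adds ?submxMl//.
  by rewrite -[X in (X <= _)%MS](scalerK (invr_neq0 c0)) scalemx_sub.
- by rewrite (submx_trans CQ)// -addsmxE addsmxSr.
Qed.

Lemma full_rank_orthonormal_basis m r (A : 'M[R]_(m, r)) : \rank A = r ->
  exists Q, orthonormal_basis A Q.
Proof.
move=> rA; have /orthonormal_rows[Q QQ QA] : row_free A^T.
  by rewrite /row_free mxrank_tr rA.
by exists Q^T; split; rewrite trmxK.
Qed.

(** The sum is the trace of [Q^T *m Q], the identity of size [r]. *)
Lemma sum_leverage m r (A : 'M[R]_(m, r)) : \rank A = r ->
  \sum_i leverage A i = r%:R.
Proof.
move=> /full_rank_orthonormal_basis[Q bQ].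
under eq_bigr do rewrite (leverageE _ bQ).
by rewrite frob2_sum_row frob2E bQ.1 mxtrace1.
Qed.

(** [A] is [Q] times a square matrix, so a zero row of [Q] gives a zero row of [A]. *)
Lemma leverage_eq0 m r (A : 'M[R]_(m, r)) i : \rank A = r ->
  leverage A i = 0 -> row i A = 0.
Proof.
move=> /full_rank_orthonormal_basis[Q bQ].
rewrite (leverageE _ bQ) => /eqP; rewrite frob2_eq0 => /eqP Qi0.
have /submxP[M /(congr1 trmx)] : (A^T <= Q^T)%MS by rewrite (eqmxP bQ.2).
by rewrite trmx_mul !trmxK => ->; rewrite row_mul Qi0 mul0mx.
Qed.

End Leverage.

(** * Directional derivative of a function that is quadratic along a line *)

Section Derivative.
Context {R : realType}.

(** The difference quotient is exactly [c + h * e]. The objective is quadratic in each factor, so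
    all gradients are read off this way. *)
Lemma derive_quadratic (V : normedModType R) (f : V -> R) (a v : V) (c e : R) :
  (forall h, f (h *: v + a) = f a + h * c + h ^+ 2 * e) -> 'D_v f a = c.
Proof.
move=> fE; apply/cvg_lim; first exact: norm_hausdorff.
have : (fun h => c + h * e) @ (0 : R)^' --> c + 0 * e.
  apply: cvgD; first exact: cvg_cst.
  by apply: cvgM; [exact: nbhs_dnbhs | exact: cvg_cst].
rewrite mul0r addr0; apply: cvg_trans; apply: near_eq_cvg.
near=> h; have h0 : h != 0 by near: h; exact: nbhs_dnbhs_neq.
rewrite /= fE (_ : _ - f a = h * (c + h * e)); last by ring.
by rewrite /GRing.scale/= mulKf.
Unshelve. all: by end_near. Qed.

End Derivative.

(** * Counting and distributivity for dependent finite functions *)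

Section Dffun.
Context {I : finType} (T_ : I -> finType).

Lemma card_dffun_prod : #|{dffun forall i, T_ i}| = (\prod_i #|T_ i|)%N.
Proof. by rewrite -card_fprod; apply: bij_eq_card (@fprod_of_dffun_bij _ _). Qed.

Lemma sum_dffun_prod (R : comPzSemiRingType) (F : forall i, T_ i -> R) :
  \sum_(g : {dffun forall i, T_ i}) \prod_i F i (g i) = \prod_i \sum_x F i x.
Proof.
rewrite (reindex (@dffun_of_fprod I T_))/=; last exact/onW_bij/dffun_of_fprod_bij.
transitivity (\sum_(t : fprod T_) \prod_(i in I) [ffun x => F i x] (t i)).
  by apply: eq_bigr => t _; apply: eq_bigr => i _; rewrite !ffunE.
rewrite big_fprod -(bigA_distr_big_dep (fun i => tagged_with T_ i)
  (fun i => untag 0 [ffun x => F i x])); apply: eq_bigr => i _.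
rewrite -(big_tag (fun i x => [ffun x => F i x] x)).
by apply: eq_bigr => x _; rewrite ffunE.
Qed.

End Dffun.

(** * Bijection between tensor indices and (column, row) pairs of an unfolding *)

Section Coordinates.
Context {R : realType} {N : nat} (dim : 'I_N -> nat) (rk : nat).
Hypothesis rk_lt_dim : forall k, (rk < dim k)%N.
Local Notation coord := (Defs.coord rk_lt_dim).

Lemma J_gt0 n : (0 < J dim n)%N.
Proof. by apply: prodn_gt0 => k; exact: leq_ltn_trans (rk_lt_dim k). Qed.

Lemma coord_inj n (j j' : 'I_(J dim n)) :
  (forall k, k != n -> coord j k = coord j' k) -> j = j'.
Proof.
move=> jj'; apply: val_inj; rewrite /= -(coord_sum rk_lt_dim j).
by rewrite -[RHS](coord_sum rk_lt_dim); apply: eq_bigr => k /jj' ->.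
Qed.

Definition index_of n (ja : 'I_(J dim n) * 'I_(dim n)) :
    {dffun forall k : 'I_N, 'I_(dim k)} :=
  finfun (dfwith (coord ja.1) n ja.2).

(** Injectivity comes from the uniqueness of mixed-radix digits, bijectivity from equal
    cardinalities. *)
Lemma index_of_bij n : bijective (@index_of n).
Proof.
apply: inj_card_bij.
  move=> [j a] [j' a'] /ffunP jaE; congr pair; last first.
    by have := jaE n; rewrite !ffunE !dfwithin.
  apply: coord_inj => k kn; have := jaE k.
  by rewrite !ffunE !dfwithout// eq_sym.
rewrite card_dffun_prod card_prod !card_ord.
under eq_bigr do rewrite card_ord.
by rewrite (bigD1 n)//= mulnC.
Qed.

Lemma sum_index_of n (F : {dffun forall k : 'I_N, 'I_(dim k)} -> R) :
  \sum_g F g = \sum_j \sum_a F (@index_of n (j, a)).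
Proof.
rewrite (reindex _ (onW_bij _ (index_of_bij n)))/= pair_bigA.
by apply: eq_bigr => -[].
Qed.

Lemma sum_coord_prod n (F : forall k, 'I_(dim k) -> R) :
  \sum_(j < J dim n) \prod_(k < N | k != n) F k (coord j k) =
  \prod_(k < N | k != n) \sum_x F k x.
Proof.
have dim0 : (0 < dim n)%N := leq_ltn_trans (leq0n _) (rk_lt_dim n).
(* A point mass at index 0 in mode [n] has total 1, so the product over all modes reduces to the
   product over the modes other than [n]. *)
pose F' k (x : 'I_(dim k)) := if k == n then (val x == 0%N)%:R else F k x.
have F'n : \sum_x F' n x = 1.
  rewrite (bigD1 (Ordinal dim0))//= big1 ?addr0 /F' ?eqxx// => x.
  by rewrite -val_eqE/= => /negPf ->.
have := sum_dffun_prod F'; rewrite (sum_index_of n) (bigD1 n)//= F'n mul1r.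
rewrite [RHS](eq_bigr (fun k => \sum_x F k x)) => [<-|k /negPf kn]; last first.
  by apply: eq_bigr => x _; rewrite /F' kn.
apply: eq_bigr => j _; rewrite -[LHS]mul1r -[X in X * _ = _]F'n mulr_suml.
apply: eq_bigr => a _; rewrite [RHS](bigD1 n)//= ffunE dfwithin; congr (_ * _).
apply: eq_bigr => k kn.
by rewrite ffunE dfwithout 1?eq_sym// /F' (negPf kn).
Qed.

End Coordinates.

(** * Gradients of the objective and of its row terms *)

Section Gradients.
Context {R : realType} {N : nat} (dim : 'I_N -> nat) (rk : nat).
Hypothesis rk_lt_dim : forall k, (rk < dim k)%N.
Variable X : tensor (R := R) dim.
Implicit Types th : factors (R := R) dim rk.
Local Notation khatri_rao := (khatri_rao rk_lt_dim).
Local Notation unfold := (unfold rk_lt_dim).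

Lemma khatri_rao_set_factor th n B :
  khatri_rao (set_factor th (n := n) B) n = khatri_rao th n.
Proof.
apply/matrixP => j r; rewrite !mxE; apply: eq_bigr => k kn.
by rewrite /set_factor dfwithout// eq_sym.
Qed.

Definition residual th n : 'M[R]_(dim n, J dim n) :=
  th n *m (khatri_rao th n)^T - unfold X n.

Lemma objective_row_set_factor th n (j : 'I_(J dim n)) B :
  objective_row rk_lt_dim X j (set_factor th B) =
  (J dim n)%:R / 2 *
    frob2 (row j (khatri_rao th n) *m B^T - row j (unfold X n)^T).
Proof. by rewrite /objective_row khatri_rao_set_factor /set_factor dfwithin. Qed.

(** Exact expansion along an entry direction; the coefficient of [h] is the partial derivative. *)
Lemma objective_row_quadratic th n (j : 'I_(J dim n)) a r h :
  objective_row rk_lt_dim X j (set_factor th (h *: delta_mx a r + th n)) =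
  objective_row rk_lt_dim X j (set_factor th (th n))
  + h * ((J dim n)%:R * (residual th n a j * khatri_rao th n j r))
  + h ^+ 2 * ((J dim n)%:R / 2 *
      frob2 (row j (khatri_rao th n) *m (delta_mx a r)^T)).
Proof.
rewrite !objective_row_set_factor.
set z := row j _; set x := row j (unfold X n)^T.
have -> : z *m (h *: delta_mx a r + th n)^T - x =
    (z *m (th n)^T - x) + h *: (z *m (delta_mx a r)^T).
  by rewrite linearD linearZ mulmxDr -scalemxAr -addrA addrC.
rewrite frob2DZ.
have -> : \sum_k (z *m (th n)^T - x) ord0 k * (z *m (delta_mx a r)^T) ord0 k =
    residual th n a j * khatri_rao th n j r.
  rewrite (bigD1 a)//= big1 ?addr0 => [|k ka]; last first.
    rewrite [X in _ * X]mxE big1 ?mulr0// => i _.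
    by rewrite !mxE (negPf ka) mulr0.
  congr (_ * _).
    rewrite !mxE; congr (_ - _); apply: eq_bigr => i _.
    by rewrite !mxE mulrC.
  rewrite mxE (bigD1 r)//= big1 ?addr0 => [|i ir]; last first.
    by rewrite !mxE (negPf ir) andbF mulr0.
  by rewrite !mxE !eqxx mulr1.
by field.
Qed.

Lemma grad_objective_row th n (j : 'I_(J dim n)) :
  grad n (objective_row rk_lt_dim X j) th =
  (J dim n)%:R *: (col j (residual th n) *m row j (khatri_rao th n)).
Proof.
apply/matrixP => a r; rewrite mxE (derive_quadratic (objective_row_quadratic _ _ _ _)).
by rewrite [RHS]mxE [X in _ = _ * X]mxE big_ord1 !mxE.
Qed.

Lemma objective_mean th n :
  objective X th = (J dim n)%:R^-1 * \sum_j objective_row rk_lt_dim X (n := n) j th.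
Proof.
rewrite /objective_row -mulr_sumr mulrA mulrA mulVf ?mul1r; last first.
  by rewrite pnatr_eq0 -lt0n (J_gt0 rk_lt_dim).
rewrite /objective (sum_index_of rk_lt_dim n); congr (_ * _).
apply: eq_bigr => j _; rewrite /frob2 big_ord1; apply: eq_bigr => a _.
rewrite -sqrrN opprB !mxE; congr ((_ - _) ^+ 2).
apply: eq_bigr => r _; rewrite !mxE (bigD1 n)//= ffunE dfwithin mulrC.
congr (_ * _); apply: eq_bigr => k kn.
by rewrite ffunE dfwithout// eq_sym.
Qed.

Lemma grad_objective th n :
  grad n (objective X) th =
  \sum_j col j (residual th n) *m row j (khatri_rao th n).
Proof.
apply/matrixP => a r; rewrite mxE.
have Jn0 : (J dim n)%:R != 0 :> R by rewrite pnatr_eq0 -lt0n (J_gt0 rk_lt_dim).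
(* The coefficients are the averages over [j] of those in [objective_row_quadratic]; the factor
   [J dim n] cancels in the linear one. *)
rewrite (@derive_quadratic _ _ _ _ _
  (\sum_j residual th n a j * khatri_rao th n j r)
  ((J dim n)%:R^-1 * \sum_j ((J dim n)%:R / 2 *
      frob2 (row j (khatri_rao th n) *m (delta_mx a r)^T)))) => [|h].
  by rewrite summxE; apply: eq_bigr => j _; rewrite [RHS]mxE big_ord1 !mxE.
rewrite !(objective_mean _ n).
under eq_bigr do rewrite objective_row_quadratic.
rewrite !big_split/= -!mulr_sumr !mulrDr; congr (_ + _ + _).
  by rewrite mulrCA mulKf.
by rewrite mulrCA.
Qed.

End Gradients.

(** * The two sampling laws: total mass and zero-probability rows *)

Section Probabilities.
Context {R : realType} {N : nat} (dim : 'I_N -> nat) (rk : nat).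
Hypothesis (rk_gt0 : (0 < rk)%N) (rk_lt_dim : forall k, (rk < dim k)%N).
Implicit Types th : factors (R := R) dim rk.

(** Both laws are products of one law per mode, each of total mass 1. *)
Lemma sum_prob s th n : admissible s th n ->
  \sum_j prob rk_lt_dim s th (n := n) j = 1.
Proof.
case: s => /= adm.
- rewrite (sum_coord_prod rk_lt_dim n (fun k x => leverage (th k) x / rk%:R)).
  rewrite big1// => k /adm rkk; rewrite -mulr_suml sum_leverage// divff//.
  by rewrite pnatr_eq0 -lt0n.
- rewrite (sum_coord_prod rk_lt_dim n (fun k x => frob2 (row x (th k)) / frob2 (th k))).
  rewrite big1// => k /adm rkk.
  by rewrite -mulr_suml frob2_sum_row divff// frob2_eq0.
Qed.

(** A vanishing product has a vanishing factor, which forces the sampled row of some factor matrix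
    to be zero; the Hadamard product then vanishes. *)
Lemma row_khatri_rao_eq0 s th n j : admissible s th n ->
  prob rk_lt_dim s th (n := n) j = 0 -> row j (khatri_rao rk_lt_dim th n) = 0.
Proof.
move=> adm p0.
suff [k kn k0] : exists2 k, k != n & row (Defs.coord rk_lt_dim j k) (th k) = 0.
  apply/rowP => r; rewrite !mxE (bigD1 k)//=.
  by move/rowP/(_ r): k0; rewrite !mxE => ->; rewrite mul0r.
case: s adm p0 => /= adm /eqP /prodf_eq0[k kn]; rewrite mulf_eq0 invr_eq0.
- rewrite pnatr_eq0 (gtn_eqF rk_gt0) orbF => /eqP l0.
  by exists k => //; exact: leverage_eq0 (adm k kn) l0.
- rewrite !frob2_eq0 (negPf (adm k kn)) orbF => /eqP l0.
  by exists k.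
Qed.

End Probabilities.

(** * The variance identity for fixed factors and a fixed mode *)

Section BatchVariance.
Context {R : realType} {N : nat} (dim : 'I_N -> nat) (rk : nat).
Hypothesis (rk_gt0 : (0 < rk)%N) (rk_lt_dim : forall k, (rk < dim k)%N).
Variables (X : tensor (R := R) dim) (bsize : 'I_N -> nat).

Lemma sgradE s (th : factors (R := R) dim rk) n (z : batch dim bsize n) :
  let p := prob rk_lt_dim s th (n := n) in
  sgrad rk_lt_dim X s th z = (bsize n)%:R^-1 *: \sum_(i < bsize n)
    ((p (tnth z i))^-1 *: (col (tnth z i) (residual rk_lt_dim X th n) *m
                           row (tnth z i) (khatri_rao rk_lt_dim th n))).
Proof.
move=> p; rewrite /sgrad invfM -scalerA; congr (_ *: _).
rewrite scaler_sumr; apply: eq_bigr => i _.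
rewrite grad_objective_row !scalerA mulrAC mulVf ?mul1r//.
by rewrite pnatr_eq0 -lt0n (J_gt0 rk_lt_dim).
Qed.

Lemma batch_variance s (th : factors (R := R) dim rk) n :
  (0 < bsize n)%N -> admissible s th n ->
  let p := prob rk_lt_dim s th (n := n) in
  \sum_(z : batch dim bsize n) (\prod_i p (tnth z i)) *
     frob2 (sgrad rk_lt_dim X s th z - grad n (objective X) th) =
  (bsize n)%:R^-1 *
    (\sum_(j < J dim n | p j != 0)
      (p j)^-1 * frob2 (col j (residual rk_lt_dim X th n)) *
        frob2 (row j (khatri_rao rk_lt_dim th n)))
  - (bsize n)%:R^-1 * frob2 (grad n (objective X) th).
Proof.
move=> b0 adm p.
pose U j := col j (residual rk_lt_dim X th n) *m row j (khatri_rao rk_lt_dim th n).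
have U0 j : p j = 0 -> U j = 0.
  by move=> /(row_khatri_rao_eq0 rk_gt0 adm) Z0; rewrite /U Z0 mulmx0.
(* Unbiasedness: the full gradient is the [p]-mean of the reweighted terms. Where [p j = 0] the
   inverse is 0, and nothing is lost because [U j = 0]. *)
have gradE : grad n (objective X) th = \sum_j p j *: ((p j)^-1 *: U j).
  rewrite (grad_objective rk_lt_dim); apply: eq_bigr => j _; rewrite scalerA.
  have [pj0|pj0] := eqVneq (p j) 0; last by rewrite divff// scale1r.
  by rewrite -/(U j) U0// scaler0.
under eq_bigr do rewrite sgradE gradE.
rewrite (frob2_variance_mean (sum_prob rk_gt0 rk_lt_dim adm)
  (fun j => (p j)^-1 *: U j) b0).
rewrite -gradE mulrBr; congr (_ * _ - _).
rewrite [RHS]big_mkcond/=; apply: eq_bigr => j _.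
rewrite frob2Z frob2_mul_col_row -/(p j).
have [pj0|pj0] := eqVneq (p j) 0; first by rewrite pj0 mul0r.
by rewrite expr2 !mulrA divff// mul1r.
Qed.

End BatchVariance.

(** * Measurability and integration through a finite-valued map *)

Section FiniteValued.
Context {d : measure_display} {T : measurableType d} {F : finType}.
Variable phi : T -> F.
Hypothesis mphi : forall x, measurable [set w | phi w = x].

Lemma finite_valued_preimage (B : set F) : measurable (phi @^-1` B).
Proof.
rewrite (_ : _ @^-1` _ = \bigcup_(x in B) [set w | phi w = x]).
  by apply: fin_bigcup_measurable.
apply/seteqP; split=> [w Bw|w [x Bx wx]]; first by exists (phi w).
by rewrite /preimage/= wx.
Qed.

(** Such a preimage is a finite union of fibres of [phi]. *)
Lemma factor_preimage (U : Type) (g : T -> U) (B : set U) :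
  (forall w w', phi w = phi w' -> g w = g w') -> measurable (g @^-1` B).
Proof.
move=> gphi; rewrite (_ : _ @^-1` _ = phi @^-1` (phi @` (g @^-1` B))).
  exact: finite_valued_preimage.
apply/seteqP; split=> [w Bw|w [w' Bw' /gphi]]; first by exists w.
by rewrite /= => <-.
Qed.

Context {R : realType} (P : {finite_measure set T -> \bar R}).

Lemma factor_integrable (g : T -> R) :
  (forall w w', phi w = phi w' -> g w = g w') ->
  P.-integrable setT (EFin \o g).
Proof.
move=> gphi; apply: measurable_bounded_integrable => //.
- by rewrite ltey_eq fin_num_measure.
- by move=> _ B mB; rewrite setTI; exact: factor_preimage.
(* [g] factors as [f] after [phi], hence is bounded by the finite sum of the [|f x|]; the default
   [point] is reached only on empty fibres. *)
pose f x := g (xget point [set w | phi w = x]).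
have gE w : g w = f (phi w).
  by rewrite /f; case: xgetP => [w' _ /gphi ->|/(_ w erefl)].
exists (\sum_x `|f x|); split; first by rewrite num_real.
move=> r ltr w _; rewrite /= gE (le_trans _ (ltW ltr))//.
by rewrite (bigD1 (phi w))//= lerDl sumr_ge0.
Qed.

Lemma integral_fibres (A : set T) (g : T -> R) :
  measurable A -> P.-integrable setT (EFin \o g) ->
  (\int[P]_(w in A) (g w)%:E =
   \sum_x \int[P]_(w in A `&` [set w | phi w = x]) (g w)%:E)%E.
Proof.
move=> mA /measurable_int mg.
rewrite -integral_bigsetU_EFin//=.
- congr (integral _ _ _); apply/seteqP; split => [w Aw|w].
    by rewrite -bigcup_seq; exists (phi w) => //=; rewrite mem_index_enum.
  by rewrite -bigcup_seq => -[x _ []].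
- by move=> x; exact: measurableI.
- exact: index_enum_uniq.
- by apply/trivIsetP => x y _ _ /eqP xy; apply/seteqP; split => // w [[_ /= ->] []].
- exact: measurable_funS mg.
Qed.

End FiniteValued.

(** * Joint fibres of finitely many finite-valued maps *)

Section FiniteFamily.
Context {d : measure_display} {T : measurableType d} {I F : finType}.

Lemma ffun_fibre_measurable (phi : I -> T -> F) (h : {ffun I -> F}) :
  (forall i x, measurable [set w | phi i w = x]) ->
  measurable [set w | [ffun i => phi i w] = h].
Proof.
move=> mphi; rewrite (_ : [set _ | _] = \bigcap_(i in setT) [set w | phi i w = h i]).
  by apply: fin_bigcap_measurable.
apply/seteqP; split=> [w /= <- i _|w wh]; first by rewrite /= ffunE.
by apply/ffunP => i; rewrite ffunE; exact: wh.
Qed.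

End FiniteFamily.

(** * Generated sigma-algebras and unions of fibres *)

Section Saturated.
Context {T U : Type}.

(** The sets stable under having equal image by [phi] themselves form a sigma-algebra. *)
Lemma sigma_algebra_saturated (phi : T -> U) (G : set (set T)) :
  (forall A, G A -> forall w w', phi w = phi w' -> A w -> A w') ->
  forall A, <<s G >> A -> forall w w', phi w = phi w' -> A w -> A w'.
Proof.
move=> Gsat; apply: smallest_sub => //; split => //.
- by move=> A Asat w w' ww' [_ Aw]; split => // /(Asat w' w (esym ww')).
- by move=> A Asat w w' ww' [n _ Aw]; exists n => //; exact: Asat ww' Aw.
Qed.

End Saturated.

(** * Atoms of the past of the process and the batch law on them *)

Section SamplingProcess.
Context {R : realType} {N : nat} (dim : 'I_N -> nat) (rk : nat).
Hypothesis (rk_lt_dim : forall k, (rk < dim k)%N).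
Variables (X : tensor (R := R) dim) (bsize : 'I_N -> nat).
Context {d : measure_display} {T : measurableType d}.
Variables (P : probability T R) (alpha : nat -> R) (sch : nat -> 'I_N -> sampling)
  (th0 : factors (R := R) dim rk) (xi : nat -> T -> 'I_N)
  (zeta : forall (s : nat) (w : T), batch dim bsize (xi s w)) (t : nat).
Hypothesis process : sampling_process rk_lt_dim P X alpha sch th0 zeta t.

(* The type of [draw], packaged as a finType. *)
Definition outcome : finType := {n : 'I_N & (bsize n).-tuple 'I_(J dim n)}.

Lemma big_outcome (V : Type) (idx : V) (op : Monoid.com_law idx) (F : outcome -> V) :
  \big[op/idx]_x F x =
  \big[op/idx]_n \big[op/idx]_(z : batch dim bsize n) F (Tagged (batch dim bsize) z).
Proof. by rewrite sig_big_dep/=; apply: eq_bigr => -[]. Qed.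

Definition drawn (s : nat) (w : T) : outcome := draw zeta s w.

(** Its nonempty fibres are the atoms of [past zeta t]. *)
Definition history (w : T) : {ffun 'I_t -> outcome} := [ffun u : 'I_t => drawn u w].

Local Notation theta := (theta rk_lt_dim X alpha sch th0 zeta).

Lemma theta_eq s w w' :
  (forall u, (u < s)%N -> drawn u w = drawn u w') -> theta s w = theta s w'.
Proof.
elim: s => // s IH dE.
(* The update takes mode and batch as one dependent pair, so equal draws can be rewritten without
   transporting the batch between types. *)
pose step (th : factors dim rk) (x : {n : 'I_N & batch dim bsize n}) : factors dim rk :=
  set_factor th (th (tag x) - alpha s *: sgrad rk_lt_dim X (sch s (tag x)) th (tagged x)).
have stepE v : theta s.+1 v = step (theta s v) (draw zeta s v) by [].
rewrite !stepE IH => [|u us]; last by apply: dE; exact: ltnW.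
by rewrite (_ : draw _ _ w = draw zeta s w')//; exact: dE.
Qed.

Lemma drawn_history w w' u : history w = history w' -> (u < t)%N ->
  drawn u w = drawn u w'.
Proof. by move=> /ffunP hE ut; have := hE (Ordinal ut); rewrite !ffunE. Qed.

Lemma theta_history w w' : history w = history w' -> theta t w = theta t w'.
Proof. by move=> hE; apply: theta_eq => u; exact: drawn_history. Qed.

Lemma drawn_measurable s (x : outcome) : (s <= t)%N ->
  measurable [set w | drawn s w = x].
Proof. exact: draw_measurable process s x. Qed.

Lemma history_past h : past zeta t [set w | history w = h].
Proof.
(* Measurability is taken in the space whose sigma-algebra is the past itself. *)
apply: (@ffun_fibre_measurable _ (g_sigma_algebraType (past_events zeta t))
  'I_t outcome drawn) => u x.
by apply: sub_sigma_algebra; exists u => //; exists x.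
Qed.

Lemma past_measurable : past zeta t `<=` measurable.
Proof.
apply: smallest_sub; first exact: sigma_algebra_measurable.
by move=> _ [u ut [x ->]]; apply: drawn_measurable; exact: ltnW.
Qed.

Lemma xi_measurable n : measurable [set w | xi t w = n].
Proof.
exact: (@finite_valued_preimage _ _ outcome (drawn t)
  (fun x => drawn_measurable x (leqnn t)) [set x | tag x = n]).
Qed.

Lemma past_and_mode_measurable : past_and_mode zeta t `<=` measurable.
Proof.
apply: smallest_sub; first exact: sigma_algebra_measurable.
move=> _ [[u ut [x ->]]|[n ->]]; last exact: xi_measurable.
by apply: drawn_measurable; exact: ltnW.
Qed.

Definition history_mode (w : T) := (history w, xi t w).

Lemma past_and_mode_saturated A : past_and_mode zeta t A ->
  forall w w', history_mode w = history_mode w' -> A w -> A w'.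
Proof.
apply: sigma_algebra_saturated => {}A GA w w' [hE nE].
case: GA => [[u ut [x ->]]|[n ->]] /=; last by rewrite nE.
by move=> <-; apply/esym; exact: drawn_history.
Qed.

Lemma history_mode_past_and_mode y : past_and_mode zeta t [set w | history_mode w = y].
Proof.
case: y => h n.
rewrite (_ : [set _ | _] = [set w | history w = h] `&` [set w | xi t w = n]).
  apply: (@measurableI _ (g_sigma_algebraType (past_events zeta t `|` _))).
    by apply: sub_sigma_algebra2 (history_past h) => A; left.
  by apply: sub_sigma_algebra; right; exists n.
by apply/seteqP; split=> w /=; rewrite /history_mode => -[-> ->].
Qed.

Lemma past_and_mode_preimage (U : Type) (g : T -> U) (B : set U) :
  (forall w w', history_mode w = history_mode w' -> g w = g w') ->
  past_and_mode zeta t (g @^-1` B).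
Proof.
exact: (@factor_preimage _ (g_sigma_algebraType (past_events zeta t `|`
  [set E | exists n, E = [set w | xi t w = n]])) _ history_mode
  history_mode_past_and_mode).
Qed.

Lemma history_mode_fibre_measurable y : measurable [set w | history_mode w = y].
Proof. by apply: past_and_mode_measurable; exact: history_mode_past_and_mode. Qed.

Lemma history_drawn_fibre_measurable y :
  measurable [set w | (history w, drawn t w) = y].
Proof.
case: y => h x.
rewrite (_ : [set _ | _] = [set w | history w = h] `&` [set w | drawn t w = x]).
  apply: measurableI; last exact: drawn_measurable.
  by apply: past_measurable; exact: history_past.
by apply/seteqP; split=> w /=; rewrite /history_mode => -[-> ->].
Qed.

(** On an atom [theta] is constant, so the integral in [batch_law] is a constant times the mass of
    the atom. *)
Lemma batch_law_history_mode w0 (z : batch dim bsize (xi t w0)) :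
  (P ([set w | history_mode w = history_mode w0] `&`
      [set w | drawn t w = Tagged _ z]) =
   (\prod_i prob rk_lt_dim (sch t (xi t w0)) (theta t w0) (tnth z i))%:E *
   P [set w | history_mode w = history_mode w0])%E.
Proof.
have hmE : [set w | history_mode w = history_mode w0] =
    [set w | history w = history w0] `&` [set w | xi t w = xi t w0].
  by apply/seteqP; split=> w /=; rewrite /history_mode => -[-> ->].
rewrite (_ : _ `&` _ = [set w | history w = history w0] `&`
    [set w | draw zeta t w = Tagged _ z]); last first.
  apply/seteqP; split => w; rewrite hmE; first by move=> [[]].
  by move=> [? wz]; split => //; split => //; exact: (congr1 tag wz).
rewrite (batch_law process z (leqnn t) (history_past _)) -hmE.
rewrite -integral_cst; last exact: history_mode_fibre_measurable.
by apply: eq_integral => w; rewrite inE => -[/theta_history -> _].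
Qed.

End SamplingProcess.

(** * The conditional variance formula *)

Theorem theorem10 (R : realType) (N : nat) (dim : 'I_N -> nat) (rk : nat)
    (rk_gt0 : (0 < rk)%N) (rk_lt_dim : forall k, (rk < dim k)%N)
    (X : tensor (R := R) dim) (bsize : 'I_N -> nat)
    (bsize_gt0 : forall n, (0 < bsize n)%N)
    (d : measure_display) (T : measurableType d) (P : probability T R)
    (alpha : nat -> R) (sch : nat -> 'I_N -> sampling)
    (th0 : factors (R := R) dim rk)
    (xi : nat -> T -> 'I_N)
    (zeta : forall (s : nat) (w : T), batch dim bsize (xi s w))
    (t : nat)
    (process : sampling_process rk_lt_dim P X alpha sch th0 zeta t) :
  let th w := theta rk_lt_dim X alpha sch th0 zeta t w in
  let G w := sgrad rk_lt_dim X (sch t (xi t w)) (th w) (zeta t w) in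
  let gradf w := grad (xi t w) (objective X) (th w) in
  let Z w := khatri_rao rk_lt_dim (th w) (xi t w) in
  let Res w := th w (xi t w) *m (Z w)^T - unfold rk_lt_dim X (xi t w) in
  let p w := prob rk_lt_dim (sch t (xi t w)) (th w) (n := xi t w) in
  is_cond_exp P (past_and_mode zeta t)
    (fun w => frob2 (G w - gradf w))
    (fun w =>
       (bsize (xi t w))%:R^-1 *
         (\sum_(j < J dim (xi t w) | p w j != 0)
            (p w j)^-1 * frob2 (col j (Res w)) * frob2 (row j (Z w)))
       - (bsize (xi t w))%:R^-1 * frob2 (gradf w))
  /\ {ae P, forall w, forall j, p w j = 0 -> row j (Z w) = 0}.
Proof.
move=> th G gradf Z Res p.
pose fX (B : factors dim rk) (x : {n : 'I_N & batch dim bsize n}) : R :=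
  frob2 (sgrad rk_lt_dim X (sch t (tag x)) B (tagged x) - grad (tag x) (objective X) B).
pose fY (B : factors dim rk) (n : 'I_N) : R :=
  let q := prob rk_lt_dim (sch t n) B (n := n) in
  (bsize n)%:R^-1 * (\sum_(j < J dim n | q j != 0)
     (q j)^-1 * frob2 (col j (residual rk_lt_dim X B n)) *
       frob2 (row j (khatri_rao rk_lt_dim B n)))
  - (bsize n)%:R^-1 * frob2 (grad n (objective X) B).
set EX := (fun w => frob2 _); set EY := (fun w => _ - _).
have EXE w : EX w = fX (th w) (draw zeta t w) by [].
have EYE w : EY w = fY (th w) (xi t w) by [].
have EX_factor w w' :
    (history zeta t w, drawn zeta t w) = (history zeta t w', drawn zeta t w') ->
    EX w = EX w'.
  move=> hdE; rewrite !EXE.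
  have /(theta_history rk_lt_dim X alpha sch th0) thE := congr1 fst hdE.
  have dE : draw zeta t w = draw zeta t w' := congr1 snd hdE.
  by rewrite /th thE dE.
have EY_factor w w' : history_mode zeta t w = history_mode zeta t w' -> EY w = EY w'.
  by move=> [/(theta_history rk_lt_dim X alpha sch th0) thE dE]; rewrite !EYE /th thE dE.
have intEX : P.-integrable setT (EFin \o EX).
  exact: (@factor_integrable _ _ _ (fun w => (history zeta t w, drawn zeta t w))
    (history_drawn_fibre_measurable process) _ P _ EX_factor).
have intEY : P.-integrable setT (EFin \o EY).
  exact: (factor_integrable (history_mode_fibre_measurable process) P EY_factor).
split; last first.
  apply: filterS (draw_admissible process) => w adm j p0.
  exact: (row_khatri_rao_eq0 rk_gt0 (adm t (leqnn t)) p0).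
split => //.
  by move=> B _; exact: past_and_mode_preimage EY_factor.
move=> A GA; have mA := past_and_mode_measurable process GA.
rewrite !(integral_fibres (history_mode_fibre_measurable process))//.
apply: eq_bigr => y _.
(* By saturation, [A] either misses the atom or contains all of it. *)
have [[w0 [Aw0 w0y]]|noA] :=
    pselect (exists w, (A `&` [set w | history_mode zeta t w = y]) w); last first.
  rewrite (_ : _ `&` _ = set0) ?integral_set0//.
  by rewrite -subset0 => w Aw; apply: noA; exists w.
rewrite (_ : _ `&` _ = [set w | history_mode zeta t w = y]); last first.
  apply/seteqP; split=> [w []//|w wy]; split => //.
  by apply: (past_and_mode_saturated GA _ Aw0); rewrite w0y wy.
move: w0y => /= <-.
set E := [set w | _].
have mE : measurable E := history_mode_fibre_measurable process _.
have iEX : P.-integrable E (EFin \o EX) by exact: integrableS measurableT mE _ intEX.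
have iEY : P.-integrable E (EFin \o EY) by exact: integrableS measurableT mE _ intEY.
(* Null atoms contribute 0 to both sides; admissibility may fail there. *)
have [PE0|PE0] := eqVneq (P E) 0%E.
  rewrite (null_set_integral mE (measurable_int _ iEX) PE0).
  by rewrite (null_set_integral mE (measurable_int _ iEY) PE0).
(* Admissibility holds almost surely and depends only on the atom, so it holds on an atom of
   positive mass. *)
have adm : admissible (sch t (xi t w0)) (th w0) (xi t w0).
  apply: contrapT => nadm; move/eqP: PE0; apply.
  apply: measure_negligible => //.
  apply: negligibleS (draw_admissible process) => w /= wE /(_ t (leqnn t)) admw.
  apply: nadm; case: wE => /(theta_history rk_lt_dim X alpha sch th0) thE nE.
  by rewrite /th -thE -nE.
transitivity ((EY w0)%:E * P E)%E.
  rewrite -integral_cst//; apply: eq_integral => w; rewrite inE => wE.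
  by rewrite /= (EY_factor _ _ wE).
(* The atom is split by the outcome of draw [t]; outcomes with another mode give empty pieces. *)
rewrite (integral_fibres (fun x => drawn_measurable process x (leqnn t)))//.
rewrite big_outcome (bigD1 (xi t w0))//= [X in (_ + X)%E]big1 ?adde0; last first.
  move=> n nw0; rewrite big1// => z _; rewrite (_ : _ `&` _ = set0) ?integral_set0//.
  rewrite -subset0 => w [/= wE wz]; move/eqP: nw0; apply.
  exact: etrans (esym (congr1 tag wz)) (congr1 snd wE).
(* On each piece the squared error is constant and the mass is the batch probability times [P E], so
   the sum is the one in [batch_variance]. *)
rewrite [in RHS](eq_bigr (fun z : batch dim bsize (xi t w0) =>
  ((\prod_i prob rk_lt_dim (sch t (xi t w0)) (th w0) (tnth z i)) *
   frob2 (sgrad rk_lt_dim X (sch t (xi t w0)) (th w0) z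
          - grad (xi t w0) (objective X) (th w0)))%:E * P E)%E).
  rewrite -(fineK (fin_num_measure P _ mE)) -EFinM.
  by rewrite (eq_bigr _ (fun _ _ => esym (EFinM _ _))) sumEFin -mulr_suml batch_variance.
move=> z _.
rewrite (eq_integral (fun=> (fX (th w0) (Tagged (batch dim bsize) z))%:E)); last first.
  move=> w; rewrite inE => -[/= wE wz]; rewrite EXE -/(drawn zeta t w).
  rewrite (_ : drawn zeta t w = Tagged (batch dim bsize) z)//.
  by rewrite /th (theta_history rk_lt_dim X alpha sch th0 (congr1 fst wE)).
rewrite integral_cst; last exact: measurableI mE (drawn_measurable process _ (leqnn t)).
rewrite EFinM [(_%:E * _%:E)%E]muleC -muleA; congr (_ * _)%E.
exact: (batch_law_history_mode process).
Qed.
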